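(* For every $\delta_0>0$ there exist constants $\bar\varepsilon=\bar\varepsilon(\delta_0)>0$ and $C=C(\delta_0)>0$, depending only on $\delta_0$, such that for all probability distributions $p$ and $q$ over a finite set $\mathcal X$ and all $\varepsilon$ with $0\le\varepsilon\le d_{\mathrm{TV}}(p,q)/4$ and $\varepsilon<\bar\varepsilon$, $$n^*_{\mathrm{Sub}}(\varepsilon)\le C\,n^*_{\mathrm{TV}}(\varepsilon)\qquad\text{and}\qquad n^*_{\mathrm{TV}}(\varepsilon)\le C\,n^*_{\mathrm{Sub}}((2+\delta_0)\varepsilon).$$
   Context: $\Delta(\mathcal X)$ is the set of probability distributions on $\mathcal X$; $d_{\mathrm{TV}}(p,q)=\frac12\sum_x|p(x)-q(x)|$. For $0\le\varepsilon<1$, $\mathcal P_{\mathrm{TV}}(p,\varepsilon)=\{p'\in\Delta(\mathcal X): d_{\mathrm{TV}}(p',p)\le\varepsilon\}$ and $\mathcal P_{\mathrm{Sub}}(p,\varepsilon)=\{p'\in\Delta(\mathcal X): p'(x)\le(1+\varepsilon)p(x)\ \forall x\in\mathcal X\}$. For $A\in\{\mathrm{TV},\mathrm{Sub}\}$, the sample complexity $n^*_A(\varepsilon)$ (for the given $p,q$) is the smallest $n$ for which there is a (possibly randomised) test $\phi:\mathcal X^n\to\{0,1\}$ with $$\sup_{P\in\mathcal P_A(p,\varepsilon)}\mathbb P_{X^n\sim P^{\otimes n}}(\phi(X^n)=1)+\sup_{Q\in\mathcal P_A(q,\varepsilon)}\mathbb P_{X^n\sim Q^{\otimes n}}(\phi(X^n)=0)\le\tfrac1{10}$$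 ($n^*_A(\varepsilon)=\infty$ if there is none). *)

(* Defs.v *)
From mathcomp Require Import all_boot all_order all_algebra.
From mathcomp Require Import all_classical all_reals ereal.

Set Implicit Arguments.
Unset Strict Implicit.
Unset Printing Implicit Defensive.

Import Order.TTheory GRing.Theory Num.Theory.

Local Open Scope classical_set_scope.
Local Open Scope ring_scope.

Record dist (R : realType) (X : finType) := Dist {
  pmf :> X -> R ;
  pmf_ge0 : forall x, 0 <= pmf x ;
  pmf_sum1 : \sum_x pmf x = 1 }.

Definition dTV (R : realType) (X : finType) (p q : dist R X) : R :=
  2^-1 * \sum_x `|p x - q x|.

Definition PTV (R : realType) (X : finType) (p : dist R X) (eps : R) :
    set (dist R X) :=
  [set p' | dTV p' p <= eps].

Definition PSub (R : realType) (X : finType) (p : dist R X) (eps : R) :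
    set (dist R X) :=
  [set p' : dist R X | forall x, p' x <= (1 + eps) * p x].

(* A randomised test is a Markov kernel from X^n to {0,1}: [phi x b] is the
   probability that the test outputs [b] on the sample [x]. *)
Definition test (R : realType) (X : finType) (n : nat) :=
  {ffun 'I_n -> X} -> dist R bool.

(* Probability that [phi] outputs [b] on an i.i.d. sample of size n from P. *)
Definition Pr_test (R : realType) (X : finType) (n : nat) (phi : test R X n)
    (P : dist R X) (b : bool) : R :=
  \sum_(x : {ffun 'I_n -> X}) (\prod_(i < n) P (x i)) * phi x b.

(* [sup] is a real supremum, with the junk value 0 on empty or unbounded sets.
   Neither occurs here: the probabilities lie in [0, 1], and the classes used
   below contain their centre as soon as 0 <= eps. *)
Definition good_test (R : realType) (X : finType) (n : nat)
    (U V : set (dist R X)) (phi : test R X n) : Prop :=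
  sup [set Pr_test phi P true | P in U] +
  sup [set Pr_test phi Q false | Q in V] <= 1 / 10.

(* The least n admitting a good test, as an extended real; it is +oo when there
   is no such n, because the infimum of the empty set is +oo. *)
Definition sample_complexity (R : realType) (X : finType)
    (U V : set (dist R X)) : \bar R :=
  ereal_inf [set n%:R%:E | n in
    [set n : nat | exists phi : test R X n, good_test U V phi]].

Definition nTV (R : realType) (X : finType) (p q : dist R X) (eps : R) :
    \bar R :=
  sample_complexity (PTV p eps) (PTV q eps).

Definition nSub (R : realType) (X : finType) (p q : dist R X) (eps : R) :
    \bar R :=
  sample_complexity (PSub p eps) (PSub q eps).

(* Main.v *)
(* Sub-contamination is a special case of TV-contamination, which gives the
   first inequality with constant 1.

   For the second, put e = (2 + delta) eps.  If n samples suffice for the Sub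
   problem, then n (1 - rho(P, Q)) >= 1/2 for every P in PSub p e and Q in
   PSub q e, where rho is the Hellinger affinity.  So it is enough to find one
   such pair (P, Q) together with a test whose error under TV-contamination
   decays like (1 - c (1 - rho(P, Q)))^m.

   The pair: P / (1 + e) is obtained from p by removing mass e / (1 + e) on
   {q < p}, and Q / (1 + e) from q by removing mass on {p < q}.  The factor
   1 + e is common to both, so the Hellinger distance splits into a part from
   {q < p} and one from {p < q}, and by symmetry the first may be assumed to be
   the larger.  The test thresholds the product of g(x_i), with g the root
   of the likelihood ratio q / p clipped to [sqrt r, 1].  Contamination at level
   eps is harmless as soon as sum (r p - q)_+ >= (1 + r) eps, whereas clipping
   p to q / r removes mass sum (p - q / r)_+.  With equality in the former this
   mass is (1 + 1/r) eps, which is below e / (1 + e) when r is close to 1. *)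
Require Import Defs.
From mathcomp Require Import all_boot all_order all_algebra.
From mathcomp Require Import all_classical all_reals ereal.
From mathcomp Require Import topology normedtype.
From mathcomp Require Import ring lra.

Set Implicit Arguments.
Unset Strict Implicit.
Unset Printing Implicit Defensive.

Import Order.TTheory GRing.Theory Num.Theory numFieldNormedType.Exports.

Local Open Scope ring_scope.

(** * Elementary power inequalities *)

Lemma bernoulli_ge (R : realDomainType) (t : R) (n : nat) :
  -1 <= t -> 1 + n%:R * t <= (1 + t) ^+ n.
Proof.
move=> t_ge; elim: n => [|n IHn]; first by rewrite expr0; lra.
rewrite exprS -natr1; apply: le_trans (_ : (1 + t) * (1 + n%:R * t) <= _).
  by have := mulr_ge0 (ler0n R n) (sqr_ge0 t); nra.
by apply: ler_wpM2l => //; lra.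
Qed.

(** Bernoulli bounds [1 + m x] by [(1 + x) ^+ m], and [(1 - x) (1 + x) <= 1]. This stands in for the
    exponential decay of [(1 - x) ^+ m]. *)
Lemma exprn_1Bx_le (R : realFieldType) (x : R) (m : nat) :
  0 <= x <= 1 -> (1 - x) ^+ m * (1 + m%:R * x) <= 1.
Proof.
move=> /andP[x0 x1].
have pow_ge0 : 0 <= (1 - x) ^+ m by apply: exprn_ge0; lra.
apply: le_trans (_ : (1 - x) ^+ m * (1 + x) ^+ m <= 1).
  by apply: ler_wpM2l => //; apply: bernoulli_ge; lra.
by rewrite -exprMn; apply: exprn_ile1; nra.
Qed.

(** * Error probabilities of tests *)

Lemma pmf_true_false (R : realType) (P : dist R bool) : P true + P false = 1.
Proof. by rewrite -(pmf_sum1 P) big_bool. Qed.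

Lemma sum_prod_ffun (R : comNzRingType) (X : finType) (n : nat) (f : X -> R) :
  \sum_(x : {ffun 'I_n -> X}) \prod_(i < n) f (x i) = (\sum_x f x) ^+ n.
Proof.
by rewrite -(bigA_distr_bigA (fun _ => f)) prodr_const card_ord.
Qed.

Lemma Pr_test_le1 (R : realType) (X : finType) (n : nat) (phi : test R X n)
  (P : dist R X) (b : bool) : Pr_test phi P b <= 1.
Proof.
rewrite -[leRHS](expr1n R n) -(pmf_sum1 P) -sum_prod_ffun.
apply: ler_sum => x _; apply: ler_piMr.
  by apply: prodr_ge0 => i _; exact: pmf_ge0.
by have := pmf_true_false (phi x); have := pmf_ge0 (phi x) true;
  have := pmf_ge0 (phi x) false; case: b; lra.
Qed.

Lemma Pr_test_le_sup (R : realType) (X : finType) (n : nat)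
  (U : set (dist R X)) (phi : test R X n) (P : dist R X) (b : bool) :
  U P -> Pr_test phi P b <= sup [set Pr_test phi P b | P in U].
Proof.
move=> UP; apply: ub_le_sup; last by exists P.
by exists 1 => _ [P' _ <-]; exact: Pr_test_le1.
Qed.

Lemma sup_Pr_test_le (R : realType) (X : finType) (n : nat)
  (U : set (dist R X)) (phi : test R X n) (P0 : dist R X) (b : bool) (M : R) :
  U P0 -> (forall P, U P -> Pr_test phi P b <= M) ->
  sup [set Pr_test phi P b | P in U] <= M.
Proof.
move=> UP0 le_M; apply: ge_sup; first by exists (Pr_test phi P0 b), P0.
by move=> _ [P UP <-]; exact: le_M.
Qed.

Lemma good_testP (R : realType) (X : finType) (n : nat)
  (U V : set (dist R X)) (phi : test R X n) (P Q : dist R X) :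
  good_test U V phi -> U P -> V Q ->
  Pr_test phi P true + Pr_test phi Q false <= 1 / 10.
Proof.
by move=> good UP VQ; apply: le_trans good; apply: lerD; exact: Pr_test_le_sup.
Qed.

Lemma good_test_subset (R : realType) (X : finType) (n : nat)
  (U V U' V' : set (dist R X)) (phi : test R X n) (P Q : dist R X) :
  (forall P, U' P -> U P) -> (forall Q, V' Q -> V Q) -> U' P -> V' Q ->
  good_test U V phi -> good_test U' V' phi.
Proof.
move=> UU' VV' UP VQ; apply: le_trans; apply: lerD.
  by apply: (sup_Pr_test_le UP) => P' /UU'; exact: Pr_test_le_sup.
by apply: (sup_Pr_test_le VQ) => Q' /VV'; exact: Pr_test_le_sup.
Qed.

(** * Sample size lower bound from the Hellinger affinity *)

Definition affinity (R : realType) (X : finType) (P Q : dist R X) : R :=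
  \sum_x Num.sqrt (P x) * Num.sqrt (Q x).

Lemma affinityE (R : realType) (X : finType) (P Q : dist R X) :
  1 - affinity P Q = 2^-1 * \sum_x (Num.sqrt (P x) - Num.sqrt (Q x)) ^+ 2.
Proof.
have -> : \sum_x (Num.sqrt (P x) - Num.sqrt (Q x)) ^+ 2 =
    \sum_x P x + \sum_x Q x - 2 * affinity P Q.
  rewrite -big_split mulr_sumr -sumrB; apply: eq_bigr => x _ /=.
  by rewrite sqrrB !sqr_sqrtr ?pmf_ge0//; ring.
by rewrite !pmf_sum1; field.
Qed.

Lemma affinity_ge0 (R : realType) (X : finType) (P Q : dist R X) :
  0 <= affinity P Q.
Proof. by apply: sumr_ge0 => x _; rewrite mulr_ge0 ?sqrtr_ge0. Qed.

(** Le Cam's two-point bound. For [u], [v] the roots of the two product densities,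
    [u v <= (u^2 + v^2) / 8 + 2 min(u^2, v^2)], and the minimum is at most what the sample
    contributes to the two errors. Summing gives [1/4 + 2/10 = 9/20]. *)
Lemma affinity_expr_le (R : realType) (X : finType) (n : nat)
  (phi : test R X n) (P Q : dist R X) :
  Pr_test phi P true + Pr_test phi Q false <= 1 / 10 ->
  affinity P Q ^+ n <= 9 / 20.
Proof.
move=> err.
pose w (P : dist R X) (x : {ffun 'I_n -> X}) := \prod_i Num.sqrt (P (x i)).
have w2 (P' : dist R X) (x : {ffun 'I_n -> X}) : \prod_i P' (x i) = w P' x ^+ 2.
  by rewrite -prodrXl; apply: eq_bigr => i _; rewrite sqr_sqrtr ?pmf_ge0.
have sum_w2 (P' : dist R X) : \sum_x w P' x ^+ 2 = 1.
  rewrite -[RHS](expr1n R n) -(pmf_sum1 P') -sum_prod_ffun.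
  by apply: eq_bigr => x _; rewrite w2.
suff : affinity P Q ^+ n <= 8^-1 * (\sum_x w P x ^+ 2 + \sum_x w Q x ^+ 2)
    + 2 * (Pr_test phi P true + Pr_test phi Q false).
  by rewrite !sum_w2; lra.
rewrite -sum_prod_ffun -!big_split !mulr_sumr -big_split /=.
apply: ler_sum => x _; rewrite big_split -/(w P x) -/(w Q x) !w2.
set u := w P x; set v := w Q x.
have u0 : 0 <= u by apply: prodr_ge0 => i _; exact: sqrtr_ge0.
have v0 : 0 <= v by apply: prodr_ge0 => i _; exact: sqrtr_ge0.
have t0 := pmf_ge0 (phi x) true; have f0 := pmf_ge0 (phi x) false.
have tf := pmf_true_false (phi x).
set a := phi x true in t0 tf *; set b := phi x false in f0 tf *.
have -> : b = 1 - a by lra.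
have {f0 tf} a1 : a <= 1 by lra.
rewrite [leLHS]/=.
have [uv|/ltW vu] := leP u v.
  have : 0 <= (v ^+ 2 - u ^+ 2) * (1 - a).
    by rewrite mulr_ge0 ?subr_ge0// ler_sqr.
  have := sqr_ge0 (v - 4 * u); nra.
have : 0 <= (u ^+ 2 - v ^+ 2) * a by rewrite mulr_ge0 ?subr_ge0// ler_sqr.
have := sqr_ge0 (u - 4 * v); nra.
Qed.

Lemma affinity_gap (R : realType) (X : finType) (n : nat)
  (phi : test R X n) (P Q : dist R X) :
  Pr_test phi P true + Pr_test phi Q false <= 1 / 10 ->
  1 / 2 <= n%:R * (1 - affinity P Q).
Proof.
move=> /affinity_expr_le; have := affinity_ge0 P Q.
move: (affinity P Q) => r r0 rn.
have := @bernoulli_ge _ (r - 1) n; have -> : 1 + (r - 1) = r by ring.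
by move=> /(_ _)/le_trans/(_ rn); rewrite -opprB; lra.
Qed.

(** * Product tests *)

Lemma bool_dirac_ge0 (R : realType) (c b : bool) : 0 <= (b == c)%:R :> R.
Proof. exact: ler0n. Qed.

Lemma bool_dirac_sum1 (R : realType) (c : bool) : \sum_b (b == c)%:R = 1 :> R.
Proof. by rewrite big_bool; case: c; rewrite /= ?addr0 ?add0r. Qed.

Definition bool_dirac (R : realType) (c : bool) : dist R bool :=
  Dist (bool_dirac_ge0 R c) (bool_dirac_sum1 R c).

Definition product_test (R : realType) (X : finType) (n : nat) (g : X -> R)
  (t : R) : test R X n :=
  fun x => bool_dirac R (t <= \prod_(i < n) g (x i)).
Arguments product_test {R X} n g t.

(* Chernoff's method: [g] plays the role of the root of a likelihood ratio. *)
Lemma product_test_good (R : realType) (X : finType) (n : nat)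
  (U V : set (dist R X)) (P0 Q0 : dist R X) (g : X -> R) (A B : R) :
  (forall x, 0 < g x) -> 0 < A -> U P0 -> V Q0 ->
  (forall P, U P -> \sum_x P x * g x <= A) ->
  (forall Q, V Q -> \sum_x Q x / g x <= B) ->
  400 * (A * B) ^+ n <= 1 ->
  exists phi : test R X n, good_test U V phi.
Proof.
move=> g0 A0 UP VQ gA gB AB.
(* By Markov, this threshold makes the first error at most [1/20]; the second is at most
   [t * B ^+ n = 20 (A B)^n], again at most [1/20]. *)
pose t := 20 * A ^+ n.
have t0 : 0 < t by rewrite mulr_gt0 ?exprn_gt0.
exists (product_test n g t).
have Q0g : 0 <= \sum_x Q0 x / g x.
  by apply: sumr_ge0 => x _; rewrite divr_ge0 ?pmf_ge0 ?ltW.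
suff errs : (forall P, U P -> Pr_test (product_test n g t) P true <= 20^-1) /\
    (forall Q, V Q -> Pr_test (product_test n g t) Q false <= 20^-1).
  have := sup_Pr_test_le UP errs.1; have := sup_Pr_test_le VQ errs.2.
  by rewrite /good_test; lra.
split=> [P /gA PA|Q /gB QB].
  have : (\sum_x P x * g x) ^+ n <= A ^+ n.
    apply: lerXn2r => //; rewrite nnegrE; last exact: ltW.
    by apply: sumr_ge0 => x _; rewrite mulr_ge0 ?pmf_ge0 ?ltW.
  rewrite -sum_prod_ffun => PAn.
  suff : t * Pr_test (product_test n g t) P true <= A ^+ n.
    by rewrite /t -mulrA; have := exprn_gt0 n A0; nra.
  apply: le_trans PAn; rewrite mulr_sumr; apply: ler_sum => x _.
  have Px : 0 <= \prod_(i < n) P (x i).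
    by apply: prodr_ge0 => i _; exact: pmf_ge0.
  rewrite big_split /= mulrCA ler_wpM2l//.
  case: (leP t) => [tg|_]; rewrite /= ?mulr1// mulr0.
  by apply: prodr_ge0 => i _; exact: ltW.
have : (\sum_x Q x / g x) ^+ n <= B ^+ n.
  apply: lerXn2r => //; rewrite nnegrE.
    by apply: sumr_ge0 => x _; rewrite divr_ge0 ?pmf_ge0 ?ltW.
  exact: le_trans Q0g (gB _ VQ).
rewrite -sum_prod_ffun => QBn.
suff : Pr_test (product_test n g t) Q false <= t * B ^+ n.
  by rewrite /t; move: AB; rewrite exprMn; lra.
apply: le_trans (ler_wpM2l (ltW t0) QBn).
rewrite mulr_sumr; apply: ler_sum => x _.
have Qx : 0 <= \prod_(i < n) Q (x i) by apply: prodr_ge0 => i _; exact: pmf_ge0.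
rewrite big_split /= mulrCA ler_wpM2l// prodfV.
have gx : 0 < \prod_(i < n) g (x i) by apply: prodr_gt0 => i _; exact: g0.
case: (leP t) => [_|gt] /=; last by rewrite ler_pdivlMr// mul1r ltW.
by rewrite divr_ge0 ?ltW.
Qed.

(** * Clipped likelihood ratios *)

(** A hockey-stick divergence; at [r = 1] it is the total variation distance. *)
Definition excess (R : realType) (X : finType) (p q : X -> R) (r : R) : R :=
  \sum_x Num.max (r * p x - q x) 0.

(** Supplies a clipping level when [r0] does not meet the requirement of [clipped_ratio_gain].
    Equality matters: it also determines the mass that clipping removes. *)
Lemma excess_IVT (R : realType) (X : finType) (p q : X -> R) (eps r0 : R) :
  r0 <= 1 -> excess p q r0 <= (1 + r0) * eps -> 2 * eps <= excess p q 1 ->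
  exists2 r, r0 <= r <= 1 & excess p q r = (1 + r) * eps.
Proof.
move=> r01 lo hi.
have cid : continuous (fun r : R => r) by move=> r; exact: cvg_id.
have cf : continuous (fun r => excess p q r - (1 + r) * eps).
  move=> r; apply: cvgB; last first.
    by apply: cvgMl; apply: cvgD; [exact: cvg_cst|exact: cid].
  have : continuous (excess p q).
    apply: continuous_big => [|x _]; first exact: add_continuous.
    move=> t; pose f (s : R) : R^o := s * p x - q x.
    apply: (@continuous_max R R f (fun=> 0) t); last exact: cvg_cst.
    by apply: cvgB; [apply: cvgMl; exact: cid|exact: cvg_cst].
  exact.
have [] := @IVT R (fun r => excess p q r - (1 + r) * eps) r0 1 0 r01.
- by move=> r; apply: continuous_subspaceT.
- have lo' : excess p q r0 - (1 + r0) * eps <= 0 by lra.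
  have hi' : 0 <= excess p q 1 - (1 + 1) * eps by lra.
  by rewrite ge_min le_max lo' hi' orbT.
move=> r; rewrite in_itv /= => rI /eqP; rewrite subr_eq0 => /eqP rE.
by exists r.
Qed.

(* The clipped root likelihood ratio separates every [eps]-contamination of [p]
   from every [eps]-contamination of [q]. *)
Lemma clipped_ratio_gain (R : realType) (X : finType) (p q : X -> R)
  (eps r : R) :
  (forall x, 0 <= p x) -> (forall x, 0 <= q x) -> 0 <= eps -> 0 < r <= 1 ->
  (1 + r) * eps <= excess p q r ->
  exists2 g : X -> R, forall x, Num.sqrt r <= g x <= 1 &
    2^-1 * (\sum_x if q x < r * p x then (1 - Num.sqrt r) ^+ 2 * p x
                   else (Num.sqrt (p x) - Num.sqrt (Num.min (p x) (q x))) ^+ 2)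
    <= \sum_x (1 - g x) * (p x - q x / g x)
       - eps * ((1 - Num.sqrt r) * (1 + (Num.sqrt r)^-1)).
Proof.
move=> p0 q0 eps0 /andP[r0 r1] excess_ge.
set a := Num.sqrt r.
have a0 : 0 < a by rewrite sqrtr_gt0.
have ra : r = a ^+ 2 by rewrite sqr_sqrtr ?ltW.
have a1 : a <= 1 by rewrite -sqrtr1 ler_wsqrtr.
(* Where [p] vanishes [g] is 1, and where only [q] vanishes it is [a], so [g] is never 0. *)
pose g x := if q x < r * p x then a
  else if q x < p x then Num.sqrt (q x) / Num.sqrt (p x) else 1.
exists g => [x|].
  rewrite /g; case: ltP => [_|qr]; first by rewrite lexx.
  case: ltP => [qp|_]; last by rewrite a1 lexx.
  have sp : 0 < Num.sqrt (p x) by rewrite sqrtr_gt0 (le_lt_trans (q0 x)).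
  rewrite ler_pdivlMr// ler_pdivrMr// mul1r (ler_wsqrtr (ltW qp)) andbT.
  by rewrite -(sqrtrM (p x) (ltW r0)) ler_wsqrtr.
(* The excess term of the gain covers the contamination loss up to [(1 - a)^2 * eps]. Since
   [clip >= 2 eps], half of the remaining sum pays for this, whence the factor [2^-1]. *)
pose clip := \sum_x if q x < r * p x then p x else 0.
have clip_ge : 2 * eps <= clip.
  suff : r * (2 * eps) <= r * clip by rewrite ler_pM2l.
  apply: le_trans (_ : (1 + r) * eps <= _); first by nra.
  apply: le_trans excess_ge _; rewrite mulr_sumr; apply: ler_sum => x _.
  have qx := q0 x; have px := p0 x.
  by case: ltP => [lt|le]; rewrite ge_max; apply/andP; split; nra.
have -> : \sum_x (1 - g x) * (p x - q x / g x) =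
    (1 - a) / a * excess p q r +
    \sum_x (if q x < r * p x then (1 - a) ^+ 2 * p x
            else (Num.sqrt (p x) - Num.sqrt (Num.min (p x) (q x))) ^+ 2).
  rewrite mulr_sumr -big_split; apply: eq_bigr => x _ /=.
  rewrite /g; case: ltP => [lt|le].
    rewrite max_l ?subr_ge0 ?ltW// ra; field; exact: lt0r_neq0.
  rewrite max_r ?subr_le0// mulr0 add0r.
  case: ltP => [qp|pq]; last by rewrite !subrr mul0r expr0n.
  have px : 0 < p x by exact: le_lt_trans qp.
  have qx : 0 < q x by apply: lt_le_trans le; exact: mulr_gt0.
  have sp : Num.sqrt (p x) != 0 by rewrite lt0r_neq0 ?sqrtr_gt0.
  have sq : Num.sqrt (q x) != 0 by rewrite lt0r_neq0 ?sqrtr_gt0.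
  rewrite -{2}(sqr_sqrtr (ltW px)) -{2}(sqr_sqrtr (ltW qx)); field.
  by rewrite sp sq.
set S := \sum_x _.
have S_ge : (1 - a) ^+ 2 * clip <= S.
  rewrite mulr_sumr; apply: ler_sum => x _.
  by case: ltP => // _; rewrite mulr0 sqr_ge0.
have : (1 - a) / a * ((1 + r) * eps) <= (1 - a) / a * excess p q r.
  by apply: ler_wpM2l => //; rewrite divr_ge0 ?subr_ge0// ltW.
have -> : (1 - a) / a * ((1 + r) * eps) =
    eps * ((1 - a) * (1 + a^-1)) - (1 - a) ^+ 2 * eps.
  by rewrite ra; field; exact: lt0r_neq0.
have := ler_wpM2l (sqr_ge0 (1 - a)) clip_ge; lra.
Qed.

(* If the clipping level is bounded away from 1, the clipped part retains a
   constant fraction of the Hellinger distance, and no mass need be removed from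
   [p].  Otherwise the mass cut off at that level fits in the budget [tau]. *)
Lemma one_sided_gain (R : realType) (X : finType) (p q : X -> R)
  (eps r0 tau : R) :
  (forall x, 0 <= p x) -> (forall x, 0 <= q x) -> 0 <= eps -> 0 < r0 < 1 ->
  2 * eps <= excess p q 1 -> (1 + r0^-1) * eps <= tau ->
  exists (u g : X -> R) (a : R), [/\ 0 < a <= 1,
    forall x, a <= g x <= 1,
    forall x, Num.min (p x) (q x) <= u x <= p x,
    \sum_x (p x - u x) <= tau &
    2^-1 * (1 - Num.sqrt r0) ^+ 2 *
      (\sum_x (Num.sqrt (u x) - Num.sqrt (Num.min (p x) (q x))) ^+ 2)
    <= \sum_x (1 - g x) * (p x - q x / g x) - eps * ((1 - a) * (1 + a^-1))].
Proof.
move=> p0 q0 eps0 /andP[r0_gt0 r0_lt1] hi tau_ge.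
have sr0 : 0 < Num.sqrt r0 by rewrite sqrtr_gt0.
have sr1 : Num.sqrt r0 <= 1 by rewrite -sqrtr1 ler_wsqrtr ?ltW.
have m0 x : 0 <= Num.min (p x) (q x) by rewrite le_min p0 q0.
have [II|I] := leP ((1 + r0) * eps) (excess p q r0).
  have r0I : 0 < r0 <= 1 by rewrite r0_gt0 ltW.
  have [g gI gain] := clipped_ratio_gain p0 q0 eps0 r0I II.
  exists p, g, (Num.sqrt r0); split=> //.
  - by rewrite sr0.
  - by move=> x; rewrite ge_min !lexx.
  - rewrite big1 => [|x _]; last by rewrite subrr.
    by apply: le_trans tau_ge; rewrite mulr_ge0// addr_ge0 ?invr_ge0 ?ltW.
  apply: le_trans gain; rewrite -mulrA ler_pM2l ?invr_gt0// mulr_sumr.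
  apply: ler_sum => x _.
  have sp0 := sqrtr_ge0 (p x); have sm0 := sqrtr_ge0 (Num.min (p x) (q x)).
  have smp : Num.sqrt (Num.min (p x) (q x)) <= Num.sqrt (p x).
    by rewrite ler_wsqrtr// ge_min lexx.
  case: ifP => _.
    rewrite ler_wpM2l ?sqr_ge0//.
    rewrite -[leRHS](sqr_sqrtr (p0 x)); nra.
  apply: ler_piMl; first exact: sqr_ge0.
  by rewrite expr_le1 ?subr_ge0//; lra.
have [r /andP[r0r r1] rE] := excess_IVT (ltW r0_lt1) (ltW I) hi.
have r_gt0 : 0 < r := lt_le_trans r0_gt0 r0r.
have rI : 0 < r <= 1 by rewrite r_gt0.
have [|g gI gain] := clipped_ratio_gain p0 q0 eps0 rI; first by rewrite rE.
have sr : 0 < Num.sqrt r by rewrite sqrtr_gt0.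
exists (fun x => Num.min (p x) (q x / r)), g, (Num.sqrt r); split=> //.
- by rewrite sr -sqrtr1 ler_wsqrtr.
- move=> x; have qr : q x <= q x / r by rewrite ler_pdivlMr// ler_piMr.
  by rewrite le_min !ge_min !lexx qr orbT.
- apply: le_trans tau_ge.
  have -> : \sum_x (p x - Num.min (p x) (q x / r)) = r^-1 * excess p q r.
    rewrite mulr_sumr; apply: eq_bigr => x _.
    have [|] := leP (p x) (q x / r); rewrite ?ler_pdivlMr ?ltr_pdivrMr// => rpq.
      by rewrite max_r ?mulr0 ?subrr// subr_le0 mulrC.
    rewrite max_l ?subr_ge0; last by rewrite mulrC ltW.
    by field; exact: lt0r_neq0.
  rewrite rE mulrA ler_wpM2r// mulrDr mulr1 mulVf ?lt0r_neq0// addrC lerD2l.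
  by rewrite lef_pV2.
apply: le_trans gain; rewrite -mulrA ler_pM2l ?invr_gt0// mulr_sumr.
apply: ler_sum => x _.
have sr01 : (1 - Num.sqrt r0) ^+ 2 <= 1 by rewrite expr_le1 ?subr_ge0//; lra.
apply: le_trans (ler_piMl (sqr_ge0 _) sr01) _.
case: ltP => [lt|le]; last first.
  by rewrite [Num.min _ (_ / _)]min_l// ler_pdivlMr// mulrC.
have qp : q x <= p x by apply: le_trans (ltW lt) _; apply: ler_piMl.
have qrp : q x / r <= p x by rewrite ler_pdivrMr// mulrC ltW.
rewrite (min_r qrp) (min_r qp) (sqrtrM _ (q0 x)) sqrtrV; last exact: ltW.
(* On the clipped part [u = q / r], so the squared root difference is [(1 - sqrt r)^2 * (q / r)], at
   most the clipped term [(1 - sqrt r)^2 * p]. *)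
have -> : Num.sqrt (q x) / Num.sqrt r - Num.sqrt (q x) =
  (1 - Num.sqrt r) * (Num.sqrt (q x) / Num.sqrt r).
  by field; exact: lt0r_neq0.
rewrite exprMn ler_wpM2l ?sqr_ge0// exprMn exprVn.
by rewrite (sqr_sqrtr (q0 x)) (sqr_sqrtr (ltW r_gt0)).
Qed.

(** * Total variation and the contamination classes *)

Lemma interpolate_sum (R : realFieldType) (X : finType) (lo hi : X -> R)
  (T : R) :
  (forall x, lo x <= hi x) -> \sum_x lo x <= T <= \sum_x hi x ->
  exists2 v : X -> R, forall x, lo x <= v x <= hi x & \sum_x v x = T.
Proof.
move=> lohi /andP[loT Thi].
have [deg|] := eqVneq (\sum_x hi x) (\sum_x lo x).
  exists lo => [x|]; first by rewrite lexx lohi.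
  by apply/eqP; rewrite eq_le loT -deg.
rewrite -subr_eq0 => gap_neq0; set gap := (X in X != 0) in gap_neq0.
have gap_gt0 : 0 < gap.
  by rewrite lt0r gap_neq0 subr_ge0 (le_trans loT).
pose w := (T - \sum_x lo x) / gap.
have w0 : 0 <= w by apply: divr_ge0; [rewrite subr_ge0|exact: ltW].
have w1 : w <= 1 by rewrite ler_pdivrMr// mul1r lerD2r.
exists (fun x => lo x + w * (hi x - lo x)) => [x|].
  by have lhx := lohi x; apply/andP; split; nra.
by rewrite big_split /= -mulr_sumr sumrB -/gap divfK// addrC subrK.
Qed.

Lemma dTV_sym (R : realType) (X : finType) (p q : dist R X) :
  dTV p q = dTV q p.
Proof. by congr (_ * _); apply: eq_bigr => x _; rewrite distrC. Qed.

Lemma dTVxx (R : realType) (X : finType) (p : dist R X) : dTV p p = 0.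
Proof. by rewrite /dTV big1 ?mulr0// => x _; rewrite subrr normr0. Qed.

Lemma excess1 (R : realType) (X : finType) (p q : dist R X) :
  excess p q 1 = dTV p q.
Proof.
have -> : excess p q 1 = \sum_x (2^-1 * `|p x - q x| + 2^-1 * (p x - q x)).
  apply: eq_bigr => x _; rewrite mul1r.
  have [pq|pq] := leP 0 (p x - q x).
    by rewrite (ger0_norm pq); lra.
  by rewrite (ltr0_norm pq); lra.
by rewrite big_split /= -!mulr_sumr sumrB !pmf_sum1 subrr mulr0 addr0.
Qed.

Lemma sum_min (R : realType) (X : finType) (p q : dist R X) :
  \sum_x Num.min (p x) (q x) = 1 - dTV p q.
Proof.
rewrite -[X in X - _](pmf_sum1 p) -excess1 -sumrB; apply: eq_bigr => x _.
rewrite mul1r; have [pq|/ltW pq] := leP (p x) (q x).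
  by rewrite max_r ?subr0 ?subr_le0.
by rewrite max_l ?subr_ge0//; ring.
Qed.

(** As [p' - p] has total mass 0, [g] may be centred at [(a + b) / 2]; it is then at most
    [(b - a) / 2] in absolute value, against an l1 distance of at most [2 eps]. *)
Lemma PTV_expectation_le (R : realType) (X : finType) (p p' : dist R X)
  (eps a b : R) (g : X -> R) :
  a <= b -> (forall x, a <= g x <= b) -> PTV p eps p' ->
  \sum_x p' x * g x <= \sum_x p x * g x + eps * (b - a).
Proof.
move=> ab gI; rewrite /PTV /dTV /= => tv.
have mean : \sum_x p' x * g x - \sum_x p x * g x =
    \sum_x (p' x - p x) * (g x - (a + b) / 2).
  under [RHS]eq_bigr do rewrite mulrBr mulrBl.
  by rewrite !sumrB -mulr_suml sumrB !pmf_sum1 subrr mul0r subr0.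
rewrite -lerBlDl mean.
apply: le_trans (_ : \sum_x `|p' x - p x| * ((b - a) / 2) <= _).
  apply: ler_sum => x _; apply: le_trans (ler_norm _) _.
  rewrite normrM ler_wpM2l// ler_norml.
  by have /andP[ag gb] := gI x; apply/andP; split; lra.
by rewrite -mulr_suml; nra.
Qed.

(** With [d = p' - p <= eps p], pointwise [|d| <= 2 eps p - d], and [d] sums to 0. *)
Lemma PSub_PTV (R : realType) (X : finType) (p p' : dist R X) (eps : R) :
  0 <= eps -> PSub p eps p' -> PTV p eps p'.
Proof.
move=> eps0 sub; rewrite /PTV /dTV /=.
suff : \sum_x `|p' x - p x| <= 2 * eps by lra.
have -> : 2 * eps = \sum_x (2 * eps * p x - (p' x - p x)).
  by rewrite !sumrB -mulr_sumr !pmf_sum1; ring.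
apply: ler_sum => x _; have := sub x; have := pmf_ge0 p x.
by rewrite ler_norml => px p'x; apply/andP; split; nra.
Qed.

Lemma PTV_refl (R : realType) (X : finType) (p : dist R X) (eps : R) :
  0 <= eps -> PTV p eps p.
Proof. by rewrite /PTV /= dTVxx. Qed.

Lemma PSub_refl (R : realType) (X : finType) (p : dist R X) (eps : R) :
  0 <= eps -> PSub p eps p.
Proof. by move=> eps0 x; have := pmf_ge0 p x; nra. Qed.

Definition flip_dist (R : realType) (P : dist R bool) : dist R bool.
Proof.
apply: (@Dist R bool (fun b => P (~~ b))) => [b|]; first exact: pmf_ge0.
by rewrite big_bool /= addrC pmf_true_false.
Defined.

Lemma good_test_sym (R : realType) (X : finType) (n : nat)
  (U V : set (dist R X)) (phi : test R X n) :
  good_test U V phi -> good_test V U (fun x => flip_dist (phi x)).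
Proof. by rewrite /good_test addrC. Qed.

(** * Robust tests and the Sub-contaminated pair *)

(** [A] and [B] bound the means of [g] and [1 / g] under contamination. The gain is
    [(1 - A) - (B - 1)], so [A B <= 1 - eta], and [1 + n eta >= 400] gives [400 (A B)^n <= 1]. *)
Lemma PTV_test_of_gain (R : realType) (X : finType) (p q : dist R X)
  (eps eta a : R) (g : X -> R) (n : nat) :
  0 <= eps -> 0 < a <= 1 -> (forall x, a <= g x <= 1) -> 0 <= eta ->
  eta <= \sum_x (1 - g x) * (p x - q x / g x)
         - eps * ((1 - a) * (1 + a^-1)) ->
  399 <= n%:R * eta ->
  exists phi : test R X n, good_test (PTV p eps) (PTV q eps) phi.
Proof.
move=> eps0 /andP[a0 a1] gI eta0 gain n_ge.
have g0 x : 0 < g x by case/andP: (gI x) => /(lt_le_trans a0).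
have gVI x : 1 <= (g x)^-1 <= a^-1.
  by have /andP[ag g1] := gI x; rewrite invf_ge1// g1 lef_pV2 ?posrE.
have aV1 : 1 <= a^-1 by rewrite invf_ge1.
pose A := \sum_x p x * g x + eps * (1 - a).
pose B := \sum_x q x / g x + eps * (a^-1 - 1).
have A0 : 0 < A.
  apply: lt_le_trans a0 _; rewrite -[leLHS]mul1r -[X in X * _](pmf_sum1 p).
  rewrite mulr_suml.
  apply: ler_wpDr; first by apply: mulr_ge0; rewrite ?subr_ge0.
  apply: ler_sum => x _; rewrite ler_wpM2l ?pmf_ge0//.
  by case/andP: (gI x).
have B1 : 1 <= B.
  apply: ler_wpDr; first by apply: mulr_ge0; rewrite ?subr_ge0.
  rewrite -[leLHS](pmf_sum1 q); apply: ler_sum => x _.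
  by rewrite ler_peMr ?pmf_ge0//; case/andP: (gVI x).
have AB : A * B <= 1 - eta.
  suff : eta <= (1 - A) - (B - 1) by nra.
  apply: le_trans gain _.
  have -> : \sum_x (1 - g x) * (p x - q x / g x) =
      (\sum_x p x - \sum_x p x * g x) - (\sum_x q x / g x - \sum_x q x).
    rewrite -!sumrB; apply: eq_bigr => x _; field; exact: lt0r_neq0.
  rewrite !pmf_sum1 /A /B.
  have -> : (1 - a) * (1 + a^-1) = a^-1 - a by field; exact: lt0r_neq0.
  lra.
apply: (@product_test_good _ _ n _ _ p q g A B) => //.
- exact: PTV_refl.
- exact: PTV_refl.
- by move=> P; exact: PTV_expectation_le.
- by move=> Q; exact: PTV_expectation_le.
have AB0 : 0 < A * B by rewrite mulr_gt0// (lt_le_trans ltr01).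
have etaI : 0 <= eta <= 1 by lra.
have := exprn_1Bx_le n etaI.
have : (A * B) ^+ n <= (1 - eta) ^+ n.
  by apply: lerXn2r => //; rewrite nnegrE; lra.
have : 0 < (A * B) ^+ n by exact: exprn_gt0.
nra.
Qed.

(** [P / (1 + e)] must have mass [1 - e / (1 + e)]. This lies between the masses of [Num.min p q]
    and [u], so some interpolant has it; staying below [u <= p] puts [P] in the class. *)
Lemma PSub_point (R : realType) (X : finType) (p q : dist R X) (e : R)
  (u : X -> R) :
  0 <= e -> e / (1 + e) <= dTV p q ->
  (forall x, Num.min (p x) (q x) <= u x <= p x) ->
  \sum_x (p x - u x) <= e / (1 + e) ->
  exists P : dist R X, PSub p e P /\
    forall x, Num.min (p x) (q x) <= P x / (1 + e) <= u x.
Proof.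
move=> e0 e_le uI u_sum.
have e1 : 0 < 1 + e by lra.
have tauE : (1 + e)^-1 = 1 - e / (1 + e) by field; exact: lt0r_neq0.
have [| |v vI v_sum] :=
  @interpolate_sum R X (fun x => Num.min (p x) (q x)) u (1 + e)^-1.
- by move=> x; case/andP: (uI x).
- rewrite sum_min tauE; move: u_sum; rewrite sumrB pmf_sum1.
  by move=> ?; apply/andP; split; lra.
have v0 x : 0 <= (1 + e) * v x.
  rewrite mulr_ge0 ?(ltW e1)//; case/andP: (vI x) => + _; apply: le_trans.
  by rewrite le_min !pmf_ge0.
have v1 : \sum_x (1 + e) * v x = 1.
  by rewrite -mulr_sumr v_sum mulfV// lt0r_neq0.
exists (Dist v0 v1); split=> x /=; last first.
  by rewrite mulrAC mulfV ?lt0r_neq0// mul1r.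
rewrite ler_pM2l//; have /andP[_ vu] := vI x; have /andP[_ up] := uI x.
exact: le_trans up.
Qed.

(* [v1] or [v2] equals [Num.min p q], according to the sign of [p - q]. *)
Lemma sqr_sqrt_sub_le (R : rcfType) (p q u1 u2 v1 v2 : R) :
  Num.min p q <= v1 <= u1 -> u1 <= p -> Num.min q p <= v2 <= u2 -> u2 <= q ->
  (Num.sqrt v1 - Num.sqrt v2) ^+ 2 <=
  (Num.sqrt u1 - Num.sqrt (Num.min p q)) ^+ 2 +
  (Num.sqrt u2 - Num.sqrt (Num.min q p)) ^+ 2.
Proof.
wlog pq : p q u1 u2 v1 v2 / p <= q => [wl|].
  have [pq|qp] := orP (le_total p q); first exact: wl.
  by move=> h1 h2 h3 h4; rewrite [leRHS]addrC -[leLHS]sqrrN opprB; exact: wl.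
rewrite minC (min_r pq) => /andP[v1p v1u] u1p /andP[v2p v2u] _.
have -> : v1 = p by apply: le_anti; rewrite v1p andbT (le_trans v1u).
apply: ler_wpDl; first exact: sqr_ge0.
rewrite -[leLHS]sqrrN opprB ler_sqr ?nnegrE ?subr_ge0 ?ler_wsqrtr// ?lerD2r.
  exact: ler_wsqrtr.
exact: le_trans v2u.
Qed.

Lemma PSub_pair_test (R : realType) (X : finType) (p q : dist R X)
  (delta eps : R) :
  0 < delta <= 1 -> 0 <= eps -> eps <= dTV p q / 4 -> eps < delta / 15 ->
  let e := (2 + delta) * eps in
  let kappa := 2^-1 * (1 - Num.sqrt (1 + delta / 2)^-1) ^+ 2 in
  exists P Q : dist R X, [/\ PSub p e P, PSub q e Q &
    forall n : nat, 399 <= n%:R * (kappa / 2 * (1 - affinity P Q)) ->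
    exists phi : test R X n, good_test (PTV p eps) (PTV q eps) phi].
Proof.
move=> /andP[d0 d1] eps0 eps_tv eps_d e kappa.
have e0 : 0 <= e by rewrite /e; nra.
have e1 : e <= 1 by rewrite /e; nra.
have e1_gt0 : 0 < 1 + e by lra.
have tau_le : e / (1 + e) <= dTV p q.
  rewrite ler_pdivrMr//; apply: le_trans (_ : dTV p q * 1 <= _); last by nra.
  by rewrite /e; nra.
(* With this [r0], [1 + 1 / r0 = 2 + delta / 2]. The slack [delta / 2] against [2 + delta] absorbs
   the division by [1 + e], because [eps < delta / 15]. *)
have r0I : 0 < (1 + delta / 2)^-1 < 1 by rewrite invr_gt0 invf_lt1; lra.
have tau_ge : (1 + (1 + delta / 2)^-1^-1) * eps <= e / (1 + e).
  rewrite invrK ler_pdivlMr// /e.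
  set K := (1 + (1 + delta / 2)) * (2 + delta).
  have K_le : K <= 15 / 2 by rewrite /K; nra.
  have Keps : K * eps <= delta / 2 by nra.
  have := ler_wpM2l eps0 Keps; rewrite /K; lra.
have [|u1 [g1 [a1 [a1I g1I u1I u1_sum gain1]]]] :=
  one_sided_gain (pmf_ge0 p) (pmf_ge0 q) eps0 r0I _ tau_ge.
  by rewrite excess1; lra.
have [|u2 [g2 [a2 [a2I g2I u2I u2_sum gain2]]]] :=
  one_sided_gain (pmf_ge0 q) (pmf_ge0 p) eps0 r0I _ tau_ge.
  by rewrite excess1 dTV_sym; lra.
have [P [Pp PI]] := PSub_point e0 tau_le u1I u1_sum.
have [|Q [Qq QI]] := PSub_point e0 _ u2I u2_sum; first by rewrite dTV_sym.
exists P, Q; split=> // n n_ge.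
rewrite -/kappa in gain1 gain2.
set S1 := \sum_x _ in gain1; set S2 := \sum_x _ in gain2.
have S10 : 0 <= S1 by apply: sumr_ge0 => x _; exact: sqr_ge0.
have S20 : 0 <= S2 by apply: sumr_ge0 => x _; exact: sqr_ge0.
have kappa0 : 0 <= kappa by rewrite mulr_ge0 ?sqr_ge0 ?invr_ge0.
(* Rescaling both distributions by [1 + e <= 2] cancels the factor [2^-1] of [affinityE]. *)
have aff_le : 1 - affinity P Q <= S1 + S2.
  rewrite affinityE.
  have -> : \sum_x (Num.sqrt (P x) - Num.sqrt (Q x)) ^+ 2 = (1 + e) *
      \sum_x (Num.sqrt (P x / (1 + e)) - Num.sqrt (Q x / (1 + e))) ^+ 2.
    rewrite mulr_sumr; apply: eq_bigr => x _.
    rewrite -{1}(sqr_sqrtr (ltW e1_gt0)) -exprMn mulrBr -!sqrtrM ?ltW//.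
    by rewrite !mulrA ![(1 + e) * _]mulrC !mulfK ?lt0r_neq0.
  set S := \sum_x _.
  have S0 : 0 <= S by apply: sumr_ge0 => x _; exact: sqr_ge0.
  have : S <= S1 + S2.
    rewrite -big_split; apply: ler_sum => x _.
    have /andP[_ up] := u1I x; have /andP[_ uq] := u2I x.
    exact: sqr_sqrt_sub_le (PI x) up (QI x) uq.
  nra.
have big_gain (S : R) : S1 + S2 <= 2 * S -> 399 <= n%:R * (kappa * S).
  move=> S12; apply: le_trans n_ge _; apply: ler_wpM2l => //.
  by rewrite -mulrA ler_wpM2l//; lra.
have [S21|/ltW S12] := leP S2 S1.
  by apply: PTV_test_of_gain gain1 _ => //;
    [exact: mulr_ge0|apply: big_gain; lra].
have [||phi /good_test_sym good] :=
  PTV_test_of_gain eps0 a2I g2I _ gain2 (n := n).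
- exact: mulr_ge0.
- by apply: big_gain; lra.
by exists (fun x => flip_dist (phi x)).
Qed.

(** * Comparison of sample complexities *)

Lemma sample_complexity_ge0 (R : realType) (X : finType)
  (U V : set (dist R X)) : (0 <= sample_complexity U V)%E.
Proof. by apply: le_ereal_inf_tmp => _ [n _ <-]; rewrite lee_fin. Qed.

Lemma sample_complexity_subset (R : realType) (X : finType)
  (U V U' V' : set (dist R X)) (P Q : dist R X) :
  (forall P, U' P -> U P) -> (forall Q, V' Q -> V Q) -> U' P -> V' Q ->
  (sample_complexity U' V' <= sample_complexity U V)%E.
Proof.
move=> UU' VV' UP VQ; apply: ereal_inf_le_tmp => _ [n [phi good] <-].
by exists n => //; exists phi; exact: good_test_subset UU' VV' UP VQ good.
Qed.

Lemma sample_complexity_scale (R : realType) (X : finType)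
  (U V U' V' : set (dist R X)) (k : nat) :
  (0 < k)%N ->
  (forall n (phi : test R X n), good_test U V phi ->
     exists phi' : test R X (k * n), good_test U' V' phi') ->
  (sample_complexity U' V' <= k%:R%:E * sample_complexity U V)%E.
Proof.
move=> k0 scale; have kR : 0 < k%:R :> R by rewrite ltr0n.
rewrite -lee_pdivrMl//; apply: le_ereal_inf_tmp => _ [n [phi /scale good] <-].
rewrite lee_pdivrMl// -EFinM -natrM.
by apply: ereal_inf_lbound; exists (k * n)%N.
Qed.

Lemma archimedean_mul (R : archiRealFieldType) (x y : R) :
  0 < y -> exists2 k : nat, (0 < k)%N & x <= k%:R * y.
Proof.
move=> y0; exists (Num.bound `|x / y|).+1; first by [].
rewrite -ler_pdivrMr//; apply: le_trans (ler_norm _) _.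
apply: le_trans (ltW (archi_boundP (normr_ge0 _))) _.
by rewrite ler_nat.
Qed.

Theorem theorem6p5 (R : realType) (delta0 : R) (delta0_gt0 : 0 < delta0) :
  exists epsbar C : R, 0 < epsbar /\ 0 < C /\
    forall (X : finType) (p q : dist R X) (eps : R),
      0 <= eps -> eps <= dTV p q / 4 -> eps < epsbar ->
      (nSub p q eps <= C%:E * nTV p q eps)%E /\
      (nTV p q eps <= C%:E * nSub p q ((2 + delta0) * eps))%E.
Proof.
(* Capping at 1 keeps the numerical estimates valid; [PSub] grows with its radius, so a pair for
   [delta] also serves [delta0]. *)
pose delta := Num.min delta0 1.
have dI : 0 < delta <= 1 by rewrite lt_min delta0_gt0 ltr01 ge_min lexx orbT.
have d_le : delta <= delta0 by rewrite ge_min lexx.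
pose kappa := 2^-1 * (1 - Num.sqrt (1 + delta / 2)^-1) ^+ 2.
have kappa_gt0 : 0 < kappa.
  rewrite mulr_gt0 ?invr_gt0// exprn_gt0// subr_gt0 -[ltRHS]sqrtr1 ltr_sqrt//.
  by rewrite invf_lt1; lra.
(* [1596 = 4 * 399]: one factor 2 offsets [kappa / 2], the other the bound [1 / 2] of
   [affinity_gap]. *)
have [k k_gt0 k_ge] := archimedean_mul 1596 kappa_gt0.
exists (delta / 15), k%:R; split; first by lra.
split=> [|X p q eps eps0 eps_tv eps_d]; first by rewrite ltr0n.
split.
  apply: le_trans (_ : nTV p q eps <= _)%E.
    apply: (@sample_complexity_subset _ _ _ _ _ _ p q).
    - by move=> P; exact: PSub_PTV.
    - by move=> Q; exact: PSub_PTV.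
    - exact: PSub_refl.
    - exact: PSub_refl.
  by apply: lee_pemull; [exact: sample_complexity_ge0|rewrite lee_fin ler1n].
apply: sample_complexity_scale => // n phi good.
have [P [Q [Pp Qq tests]]] := PSub_pair_test dI eps0 eps_tv eps_d.
have mono (r : dist R X) P' : PSub r ((2 + delta) * eps) P' ->
    PSub r ((2 + delta0) * eps) P'.
  move=> sub x; apply: le_trans (sub x) _.
  by rewrite ler_wpM2r ?pmf_ge0// lerD2l ler_wpM2r// lerD2l.
apply: tests; rewrite -/kappa.
have := affinity_gap (good_testP good (mono _ _ Pp) (mono _ _ Qq)).
set t := n%:R * _ => t_ge.
have -> : (k * n)%:R * (kappa / 2 * (1 - affinity P Q)) = k%:R * kappa * t / 2.
  by rewrite natrM /t; ring.
nra.
Qed.
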